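(* Let $C_1$ be the optimal (smallest) constant such that $\Vert f \Vert_{L^{3/2,\infty}(\mathbb{R}^3,\mathbb{C}^2)} \le C_1 \int_{\mathbb{R}^3} |(\boldsymbol{\sigma}\cdot\mathbf{p}) f(\mathbf{x})|\, d\mathbf{x}$ for all $f \in C_0^{\infty}(\mathbb{R}^3,\mathbb{C}^2)$. Then there is a constant $C_2 \le (9\pi)^{1/3} C_1$ such that for all $f \in C_0^{\infty}(\mathbb{R}^3,\mathbb{C}^2)$ $$\big\Vert f/|\cdot| \big\Vert_{L^{1,\infty}(\mathbb{R}^3,\mathbb{C}^2)} \le C_2 \int_{\mathbb{R}^3} |(\boldsymbol{\sigma}\cdot\mathbf{p}) f(\mathbf{x})|\, d\mathbf{x},$$ where $f/|\cdot|$ denotes the function $\mathbf{x}\mapsto f(\mathbf{x})/|\mathbf{x}|$, with $|\mathbf{x}|$ the Euclidean norm of $\mathbf{x}\in\mathbb{R}^3$.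
   Context: $C_0^\infty(\mathbb{R}^3,\mathbb{C}^2)$ is the space of $\mathbb{C}^2$-valued functions on $\mathbb{R}^3$ whose components are smooth with compact support. The Pauli matrices are $\sigma_1=\begin{pmatrix}0&1\\1&0\end{pmatrix}$, $\sigma_2=\begin{pmatrix}0&-i\\i&0\end{pmatrix}$, $\sigma_3=\begin{pmatrix}1&0\\0&-1\end{pmatrix}$, and $\boldsymbol{\sigma}\cdot\mathbf{p} = -i\sum_{j=1}^3 \sigma_j \frac{\partial}{\partial x_j}$. For $\mathbf{a}=(a_1,a_2)\in\mathbb{C}^2$, $|\mathbf{a}| = |a_1|+|a_2|$. For $q>0$, the weak-$L^q$ quasi-norm is $$\Vert f\Vert_{L^{q,\infty}} = \Vert f\Vert_{q,\infty} := \Big(\sup_{t>0}\, t^q \mu(\{\mathbf{x}\in\mathbb{R}^3 : |f(\mathbf{x})|>t\})\Big)^{1/q},$$ where $\mu$ is Lebesgue measure. A finite constant $C_1$ as in the claim exists. *)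

(* Defs.v *)
From HB Require Import structures.
From mathcomp Require Import all_boot all_order all_algebra.
From mathcomp Require Import all_classical all_reals all_analysis.
From mathcomp Require Import complex.

Set Implicit Arguments.
Unset Strict Implicit.
Unset Printing Implicit Defensive.

Import Order.TTheory GRing.Theory Num.Theory.
Import numFieldNormedType.Exports.

Local Open Scope classical_set_scope.
Local Open Scope ring_scope.

(* R3 has the product topology, whose library norm `|x| is the sup norm; the
   Euclidean norm is enorm below. *)
Notation R3 R := (R * R * R)%type.
Notation spinor R := 'cV[R[i]]_2.

Section definitions.
Variable R : realType.

Definition enorm (x : R3 R) : R :=
  Num.sqrt (x.1.1 ^+ 2 + x.1.2 ^+ 2 + x.2 ^+ 2).

(* measurableTypeR R is R with the sigma-algebra on which lebesgue_measure is
   defined. *)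
Definition mu3 :
    set (measurableTypeR R * measurableTypeR R * measurableTypeR R) -> \bar R :=
  ((@lebesgue_measure R \x @lebesgue_measure R) \x @lebesgue_measure R)%E.
HB.instance Definition _ := Measure.on mu3.

Definition norm1 (a : spinor R) : R := \sum_(k < 2) Normc.normc (a k 0).

Definition basis3 (j : 'I_3) : R3 R :=
  ((j == 0 :> nat)%:R, (j == 1 :> nat)%:R, (j == 2 :> nat)%:R).

Definition partial (j : 'I_3) (u : R3 R -> R) (x : R3 R) : R :=
  'D_(basis3 j) u x.

(* Partial derivatives of all orders exist and are continuous; s lists the
   directions of differentiation. *)
Definition smooth (u : R3 R -> R) : Prop :=
  forall s : seq 'I_3,
    let v := foldr partial u s in
    continuous v /\ forall (j : 'I_3) (x : R3 R), derivable v x (basis3 j).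

Definition Re_comp (f : R3 R -> spinor R) (k : 'I_2) (x : R3 R) : R :=
  complex.Re (f x k 0).

Definition Im_comp (f : R3 R -> spinor R) (k : 'I_2) (x : R3 R) : R :=
  complex.Im (f x k 0).

Definition Cc_infty (f : R3 R -> spinor R) : Prop :=
  forall k : 'I_2,
    [/\ smooth (Re_comp f k), smooth (Im_comp f k) &
        compact (closure [set x | f x k 0 != 0])].

Definition mx22 (a b c d : R[i]) : 'M[R[i]]_2 :=
  \matrix_(k, l) (if k == 0 then (if l == 0 then a else b)
                  else (if l == 0 then c else d)).

Definition pauli (j : 'I_3) : 'M[R[i]]_2 :=
  match val j with
  | 0 => mx22 0 1 1 0
  | 1 => mx22 0 (- 'i%C) 'i%C 0
  | _ => mx22 1 0 0 (-1)
  end.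

Definition dvec (j : 'I_3) (f : R3 R -> spinor R) (x : R3 R) : spinor R :=
  \col_k (partial j (Re_comp f k) x +i* partial j (Im_comp f k) x)%C.

Definition sigma_p (f : R3 R -> spinor R) (x : R3 R) : spinor R :=
  (- 'i%C) *: \sum_(j < 3) pauli j *m dvec j f x.

Definition weak_norm (q : R) (f : R3 R -> spinor R) : \bar R :=
  (ereal_sup [set (t `^ q)%:E * mu3 [set x | (t < norm1 (f x))%R]
             | t in [set t : R | (0 < t)%R]] `^ q^-1)%E.

(* Since 0^-1 = 0, the value at the origin is 0; this does not affect weak
   norms, a point being a null set. *)
Definition div_norm (f : R3 R -> spinor R) (x : R3 R) : spinor R :=
  ((enorm x)^-1)%:C%C *: f x.

Definition is_smallest (A : set R) (c : R) : Prop := A c /\ lbound A c.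

End definitions.

Arguments mu3 {R}.

(* Main.v *)
Require Import Defs.
From mathcomp Require Import all_boot all_order all_algebra.
From mathcomp Require Import all_classical all_reals all_analysis.
From mathcomp Require Import measurable_realfun complex ring lra.

(* Hoelder's inequality in weak Lebesgue spaces. If |f(x)| > t |x|, then either
   |f(x)| > s or |x| < s / t, so with M = ||f||_{3/2,oo}
     mu {|f| / |.| > t} <= (M / s)^(3/2) + (4 pi / 3) (s / t)^3
   for every s > 0. At the minimizing s the right-hand side is exactly
   (9 pi)^(1/3) M / t, so the constant C2 = (9 pi)^(1/3) C1 works. *)

Import Order.TTheory GRing.Theory Num.Theory.
Import numFieldNormedType.Exports.

Local Open Scope classical_set_scope.
Local Open Scope ring_scope.

Local Notation mR3 R :=
  (measurableTypeR R * measurableTypeR R * measurableTypeR R)%type.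

(** * Borel measurability on the triple product *)

(** Second countability: [U] is a countable union of sup-norm balls with rational centres and radii.
    Such a ball is a box, a product of three intervals, hence lies in the product sigma-algebra. *)
Lemma open_measurable_R3 (R : realType) (U : set (R3 R)) : open U ->
  measurable (U : set (mR3 R)).
Proof.
move=> oU.
pose c (i : rat * rat * rat * rat) : R3 R :=
  (ratr i.1.1.1, ratr i.1.1.2, ratr i.1.2).
pose B i : set (R3 R) := ball (c i) (ratr i.2).
(* Balls that leave [U] are replaced by [set0], so the union can run over all rational
   quadruples. *)
pose F i := if `[< B i `<=` U >] then B i else set0.
have -> : U = \bigcup_i F i.
  apply/seteqP; split => [x Ux|x [i _]]; last first.
    by rewrite /F; case: ifPn => [/asboolP|//]; exact.
  move: oU; rewrite openE => /(_ x Ux) /nbhs_ballP[e /= e0 xeU].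
  (* The centre is taken within [e / 4] of [x] in each coordinate and the radius [r] between [e / 4]
     and [e / 2]: then the ball contains [x], and its diameter bound [r + r] stays below [e]. *)
  have e40 : 0 < e / 4 by rewrite divr_gt0.
  have H (y : R) : exists q : rat, `|y - ratr q| < e / 4.
    have /rat_in_itvoo[q] : y - e / 4 < y + e / 4 by lra.
    rewrite in_itv/= => /andP[h1 h2]; exists q.
    by rewrite ltr_norml; apply/andP; split; lra.
  have [q1 hq1] := H x.1.1; have [q2 hq2] := H x.1.2; have [q3 hq3] := H x.2.
  have /rat_in_itvoo[r] : e / 4 < e / 2 by lra.
  rewrite in_itv/= => /andP[h1 h2].
  have cx : ball (c (q1, q2, q3, r)) (ratr r) x.
    rewrite /ball/= /prod_ball/=; split; [split|].
    - by rewrite /ball/= distrC; lra.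
    - by rewrite /ball/= distrC; lra.
    - by rewrite /ball/= distrC; lra.
  exists (q1, q2, q3, r) => //; rewrite /F asboolT// => y.
  move=> cy; apply: xeU.
  apply: (@le_ball _ _ _ (ratr r + ratr r)); first by lra.
  exact: (ball_triangle (ball_sym cx)).
apply: countable_bigcupT_measurable => // i; rewrite /F; case: ifPn => // _.
have -> : B i = (ball (c i).1.1 (ratr i.2) `*` ball (c i).1.2 (ratr i.2))
      `*` ball (c i).2 (ratr i.2) by [].
by apply: measurableX; first apply: measurableX; exact: measurable_ball.
Qed.

Lemma continuous_measurable_fun_R3 (R : realType) (u : R3 R -> R) :
  continuous u -> measurable_fun [set: mR3 R] (u : _ -> measurableTypeR R).
Proof.
move/continuousP => cu.
apply: (measurability _ (RGenOpens.measurableE R)) => _ [_ [a [b ->] <-]].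
by rewrite setTI; apply: open_measurable_R3; apply: cu; exact: interval_open.
Qed.

Lemma measurable_norm1 (R : realType) (f : R3 R -> spinor R) : Cc_infty f ->
  measurable_fun [set: mR3 R]
    (fun x => norm1 (f x) : measurableTypeR R).
Proof.
move=> Cf; apply: measurable_sum => k.
have -> : (fun x => Normc.normc (f x k 0)) =
    (fun x => Num.sqrt (Re_comp f k x ^+ 2 + Im_comp f k x ^+ 2)).
  by apply/funext => x; rewrite /Normc.normc /Re_comp /Im_comp; case: (f x k 0).
have [sR sI _] := Cf k.
apply: measurableT_comp.
  by apply: continuous_measurable_fun; exact: sqrt_continuous.
apply: measurable_funD; apply: measurable_funX;
  apply: continuous_measurable_fun_R3.
- exact: (sR [::]).1.
- exact: (sI [::]).1.
Qed.

(** * Volume of the Euclidean ball *)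

(** This is the area of the disc of squared radius [c], the inner integral of Tonelli's theorem
    below. For [c <= 0] the disc is degenerate and [Num.sqrt] returns 0; otherwise substitute
    [y = rho * sin x] with [rho = sqrt c]. *)
Lemma integral_sqrt_sub (R : realType) (c : R) :
  (\int[@lebesgue_measure R]_y (2 * Num.sqrt (c - y ^+ 2))%:E
    = (pi * Num.max c 0)%:E)%E.
Proof.
have [c0|c0] := leP c 0.
  rewrite mulr0 integral0_eq// => y _.
  by rewrite ler0_sqrtr ?mulr0//; have := sqr_ge0 y; lra.
pose rho := Num.sqrt c.
have r0 : 0 < rho by rewrite sqrtr_gt0.
have rE : rho ^+ 2 = c by rewrite sqr_sqrtr// ltW.
pose G (x : R) := 2 * Num.sqrt (c - x ^+ 2).
pose F : R -> R := fun x => rho * sin x.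
have p20 : 0 < pi / 2 :> R by rewrite divr_gt0 ?pi_gt0.
have cG : continuous G.
  move=> x; apply: cvgM; first exact: cvg_cst.
  apply: continuous_cvg; first exact: sqrt_continuous.
  by apply: cvgB; [exact: cvg_cst|exact: exprn_continuous].
have F'E (x : R) : is_derive x 1 F (rho * cos x).
  rewrite /F; have -> : rho * cos x = rho *: cos x by [].
  exact: is_deriveZ.
have F'1 : F^`()%classic = (fun x => rho * cos x).
  by apply/funext => x; rewrite derive1E; apply: derive_val.
have cF' : continuous F^`()%classic.
  by rewrite F'1 => x; apply: cvgM; [exact: cvg_cst|exact: continuous_cos].
have cF : continuous F.
  by move=> x; apply: cvgM; [exact: cvg_cst|exact: continuous_sin].
have Fa : F (- (pi / 2)) = - rho by rewrite /F sinN sin_pihalf; lra.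
have Fb : F (pi / 2) = rho by rewrite /F sin_pihalf; lra.
(* Outside [[-rho, rho]] the radicand is nonpositive, so the square root vanishes. *)
transitivity (\int[@lebesgue_measure R]_(x in `[F (- (pi / 2))%R, F (pi / 2)%R])
    (G x)%:E)%E.
  rewrite [RHS]integral_mkcond; apply: eq_integral => x _.
  rewrite patchE; case: ifPn => // /negP xn; congr EFin.
  rewrite ler0_sqrtr ?mulr0// subr_le0 -rE leNgt; apply/negP => h; apply: xn.
  rewrite inE/= in_itv/= Fa Fb -ler_norml -(ger0_norm (ltW r0)).
  by rewrite -ler_sqr ?nnegrE// !real_normK ?num_real// ltW.
rewrite integration_by_substitution_increasing; last first.
- exact: continuous_subspaceT.
- split.
  + by move=> x _; case: (F'E x).
  + by apply: cvg_at_right_filter; exact: cF.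
  + by apply: cvg_at_left_filter; exact: cF.
- by apply/cvg_ex; exists (F^`()%classic (pi / 2));
  apply: cvg_at_left_filter; exact: cF'.
- by apply/cvg_ex; exists (F^`()%classic (- (pi / 2)));
  apply: cvg_at_right_filter; exact: cF'.
- by move=> x _; exact: cF'.
- move=> x y xI yI xy; rewrite /F ltr_pM2l//.
  by rewrite ltr_sin//; move: xI yI; rewrite inE.
- lra.
(* An antiderivative of [2 * c * cos x ^+ 2], since [1 + cos^2 - sin^2 = 2 cos^2]. *)
pose H (x : R) := c * (x + sin x * cos x).
have H'E (x : R) : is_derive x 1 H (c * (1 + (cos x ^+ 2 - sin x ^+ 2))).
  have -> : H = c *: (id + sin * cos) by [].
  apply: is_derive_eq.
  rewrite -[LHS]/(c * (1 + (sin x * - sin x + cos x * cos x))).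
  by ring.
transitivity (\int[@lebesgue_measure R]_(x in `[(- (pi / 2))%R, (pi / 2)%R])
    (2 * c * cos x ^+ 2)%:E)%E.
  (* The sign of [cos x] lets the square root of [(rho * cos x) ^+ 2] be taken without an absolute
     value. *)
  have GF (x : R) : 0 <= cos x -> G (F x) * (rho * cos x) = 2 * c * cos x ^+ 2.
    move=> cx; rewrite /G /F.
    have -> : c - (rho * sin x) ^+ 2 = (rho * cos x) ^+ 2.
      by rewrite !exprMn rE cos2sin2; ring.
    rewrite sqrtr_sqr ger0_norm ?(mulr_ge0 (ltW r0))//.
    by rewrite -rE; ring.
  apply: eq_integral => x; rewrite inE/= in_itv/= => xI; congr EFin.
  by rewrite F'1; apply: GF; rewrite cos_ge0_pihalf.
rewrite (@continuous_FTC2 _ _ H); first last.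
- move=> x _; rewrite derive1E (@derive_val _ _ _ _ _ _ _ (H'E x)).
  by have := cos2Dsin2 x; nra.
- have cH : continuous H.
    move=> x; apply/differentiable_continuous/derivable1_diffP.
    by case: (H'E x).
  split.
  + by move=> x _; case: (H'E x).
  + by apply: cvg_at_right_filter; exact: cH.
  + by apply: cvg_at_left_filter; exact: cH.
- apply: continuous_subspaceT => x; apply: cvgM; first exact: cvg_cst.
  by apply: cvgM; exact: continuous_cos.
- lra.
by rewrite /H cosN cos_pihalf -EFinB; congr EFin; lra.
Qed.

(** The outer integral: the areas of the discs cut from the ball at height [x]. The maximum is 0
    beyond [[-r, r]], and on that interval the integrand is a polynomial. *)
Lemma integral_max_sub (R : realType) (r : R) : 0 < r ->
  (\int[@lebesgue_measure R]_x (pi * Num.max (r ^+ 2 - x ^+ 2) 0)%:E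
    = (4 / 3 * pi * r ^+ 3)%:E)%E.
Proof.
move=> r0.
transitivity (\int[@lebesgue_measure R]_(x in `[(- r)%R, r])
    (pi * (r ^+ 2 - x ^+ 2))%:E)%E.
  rewrite [RHS]integral_mkcond; apply: eq_integral => x _.
  rewrite patchE; case: ifPn => [|/negP xn].
    rewrite inE/= in_itv/= => /andP[h1 h2]; congr (_ * _)%:E.
    by apply/max_idPl; nra.
  have [_|h] := leP; first by rewrite mulr0.
  exfalso; apply: xn; rewrite inE/= in_itv/= -ler_norml -(ger0_norm (ltW r0)).
  by rewrite -ler_sqr ?nnegrE// !real_normK ?num_real//; lra.
pose H (x : R) := pi * (r ^+ 2 * x - x ^+ 3 / 3).
have H'E (x : R) : is_derive x 1 H (pi * (r ^+ 2 - x ^+ 2)).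
  have -> : H = pi *: (r ^+ 2 *: id - 3^-1 *: (@GRing.exp R ^~ 3)).
    by apply/funext => y; rewrite /H (mulrC (y ^+ 3)).
  apply: is_derive_eq.
  (* The computed derivative in plain ring operations; the cube is differentiated by iterating the
     product rule. *)
  rewrite -[LHS]/(pi * (r ^+ 2 * 1 - 3^-1 * (x * (x * 1 + x * 1) + x * x * 1))).
  by field.
have cH : continuous H.
  by move=> x; apply/differentiable_continuous/derivable1_diffP; case: (H'E x).
rewrite (@continuous_FTC2 _ _ H); first last.
- by move=> x _; rewrite derive1E (@derive_val _ _ _ _ _ _ _ (H'E x)).
- split.
  + by move=> x _; case: (H'E x).
  + by apply: cvg_at_right_filter; exact: cH.
  + by apply: cvg_at_left_filter; exact: cH.
- apply: continuous_subspaceT => x; apply: cvgM; first exact: cvg_cst.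
  by apply: cvgB; [exact: cvg_cst|exact: exprn_continuous].
- lra.
by rewrite /H -EFinB; congr EFin; field.
Qed.

Lemma measurable_enorm (R : realType) :
  measurable_fun [set: mR3 R]
    (fun x => enorm x : measurableTypeR R).
Proof.
apply: (measurableT_comp (f := @Num.sqrt R)).
  exact: (continuous_measurable_fun (@sqrt_continuous R)).
apply: measurable_funD; first apply: measurable_funD.
- apply: measurable_funX; exact: (measurableT_comp measurable_fst).
- apply: measurable_funX; exact: (measurableT_comp measurable_snd).
- exact: measurable_funX.
Qed.

Lemma measurable_ball_enorm (R : realType) (r : R) :
  measurable ([set x | enorm x < r] : set (mR3 R)).
Proof.
rewrite -[X in measurable X]setTI (_ : [set x | _] = @enorm R @^-1` `]-oo, r[).
  by apply: (@measurable_enorm R) => //; exact: measurable_itv.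
by apply/seteqP; split => x /=; rewrite in_itv.
Qed.

(** The section of the ball over a point [p] of the plane lies in an interval of length [h p];
    Tonelli then reduces the integral of [h] to the two preceding computations. *)
Lemma mu3_ball_enorm (R : realType) (r : R) : 0 < r ->
  (mu3 [set x | (enorm x < r)%R] <= (4 / 3 * pi * r ^+ 3)%:E)%E.
Proof.
move=> r0.
pose h (p : measurableTypeR R * measurableTypeR R) :=
  2 * Num.sqrt (r ^+ 2 - p.1 ^+ 2 - p.2 ^+ 2).
have mh : measurable_fun setT (h : _ -> measurableTypeR R).
  apply: measurable_funM; first exact: measurable_cst.
  apply: measurableT_comp.
    exact: (continuous_measurable_fun (@sqrt_continuous R)).
  apply: measurable_funB; first apply: measurable_funB => //.
  - exact: measurable_funX.
  - exact: measurable_funX.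
have mA := @measurable_ball_enorm R r.
apply: (@le_trans _ _
  (\int[(@lebesgue_measure R \x @lebesgue_measure R)%E]_p (h p)%:E)%E).
  (* By definition the product measure is the integral of the lengths of the sections, so these are
     compared pointwise. *)
  apply: ge0_le_integral => //.
  - exact: measurable_fun_xsection.
  - exact/measurable_EFinP.
  move=> p _ /=.
  set s := Num.sqrt (r ^+ 2 - p.1 ^+ 2 - p.2 ^+ 2).
  apply: (@le_trans _ _ (@lebesgue_measure R `]-s, s[)).
    apply: le_measure; rewrite ?inE.
    + exact: measurable_xsection.
    + exact: measurable_itv.
    + move=> z /xsectionP/=; rewrite /enorm in_itv/= -ltr_norml => hz.
      rewrite -[in ltLHS](ger0_norm (normr_ge0 z)) -sqrtr_sqr.
      rewrite real_normK ?num_real//.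
      have {hz} : p.1 ^+ 2 + p.2 ^+ 2 + z ^+ 2 < r ^+ 2.
        rewrite -(ger0_norm (ltW r0)) -sqrtr_sqr ltr_sqrt in hz => //.
        by rewrite exprn_gt0.
      by move=> hz; rewrite ltr_sqrt; have := sqr_ge0 z; lra.
  rewrite lebesgue_measure_itv/=; case: ifPn => _.
    by rewrite -EFinB lee_fin opprK /h -/s; lra.
  by rewrite lee_fin mulr_ge0 ?sqrtr_ge0.
rewrite fubini_tonelli1//=; last 2 first.
- exact/measurable_EFinP.
- by move=> p; rewrite lee_fin mulr_ge0 ?sqrtr_ge0.
rewrite /fubini_F /h/=.
under eq_integral do rewrite integral_sqrt_sub.
by rewrite integral_max_sub.
Qed.

(** * Weak quasi-norms and the splitting of the superlevel set *)

Lemma measurable_superlevel d (T : measurableType d) (R : realType)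
    (g : T -> measurableTypeR R) (c : R) :
  measurable_fun setT g -> measurable [set x | c < g x].
Proof.
move=> mg; rewrite -[X in measurable X]setTI.
rewrite (_ : [set x | _] = g @^-1` `]c, +oo[).
  by apply: mg => //; exact: measurable_itv.
by apply/seteqP; split => x /=; rewrite in_itv/= andbT.
Qed.

Lemma norm1_div_norm (R : realType) (f : R3 R -> spinor R) x :
  norm1 (div_norm f x) = (enorm x)^-1 * norm1 (f x).
Proof.
rewrite /norm1 mulr_sumr; apply: eq_bigr => k _.
rewrite mxE Normc.normcM; congr (_ * _).
rewrite /Normc.normc/= expr0n/= addr0 sqrtr_sqr ger0_norm//.
by rewrite invr_ge0 sqrtr_ge0.
Qed.

Lemma weak_norm_ge0 (R : realType) (q : R) (f : R3 R -> spinor R) :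
  (0 <= weak_norm q f)%E.
Proof. exact: poweR_ge0. Qed.

(** Raising to the power [q] undoes the outer exponent [q^-1], and the supremum dominates its term
    at [t]. *)
Lemma le_weak_norm (R : realType) (q M t : R) (f : R3 R -> spinor R) :
  0 < q -> 0 <= M -> 0 < t -> (weak_norm q f <= M%:E)%E ->
  ((t `^ q)%:E * mu3 [set x | (t < norm1 (f x))%R] <= (M `^ q)%:E)%E.
Proof.
move=> q0 M0 t0; rewrite /weak_norm; set S := ereal_sup _ => SM.
have tS : ((t `^ q)%:E * mu3 [set x | (t < norm1 (f x))%R] <= S)%E.
  by apply: ereal_sup_ubound; exists t.
have S0 : (0 <= S)%E by apply: le_trans tS; rewrite mule_ge0// lee_fin powR_ge0.
apply: (le_trans tS).
have -> : S = ((S `^ q^-1) `^ q)%E.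
  by rewrite -poweRrM mulVf ?gt_eqF// poweRe1.
rewrite -poweR_EFin; apply: gt0_ler_poweR => //.
- exact: ltW.
- by rewrite in_itv/= poweR_ge0 leey.
- by rewrite in_itv/= leey andbT lee_fin.
Qed.

(** [M] is any positive bound rather than the quasi-norm itself: the optimal [s] is proportional to
    [M^(1/3)] and has to be positive even if the quasi-norm is 0. *)
Lemma mu3_div_norm_le (R : realType) (f : R3 R -> spinor R) (M t : R) :
  Cc_infty f -> 0 < M -> 0 < t -> (weak_norm (3 / 2) f <= M%:E)%E ->
  (t%:E * mu3 [set x | (t < norm1 (div_norm f x))%R] <=
     ((9 * pi) `^ (1 / 3) * M)%:E)%E.
Proof.
move=> Cf M0 t0 fM.
set k := _ `^ _.
have pi0 := pi_gt0 R.
have k0 : 0 < k by rewrite powR_gt0// mulr_gt0.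
(* With [m = sqrt M], the bound is [m^3 / X + (4 pi / 3) X^2 / t^3], whose derivative vanishes when
   [X^3 = 3 m^3 t^3 / (8 pi)]. Since [k^3 = 9 pi], this is [X = 3 m t / (2 k)]. *)
have k3 : k ^+ 3 = 9 * pi.
  rewrite -powR_mulrn ?powR_ge0// -powRrM (_ : 1 / 3 * 3%:R = 1); last by field.
  by rewrite powRr1// mulr_ge0// ltW.
pose m := Num.sqrt M.
have m0 : 0 < m by rewrite sqrtr_gt0.
have mE : m ^+ 2 = M by rewrite sqr_sqrtr// ltW.
(* X = s^(3/2) for the minimizer s of (M / s)^(3/2) + (4 pi / 3) (s / t)^3 *)
pose X := m * t * (3 / (2 * k)).
have X0 : 0 < X by rewrite !mulr_gt0// invr_gt0 mulr_gt0.
pose s := X `^ (2 / 3).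
have s0 : 0 < s by rewrite powR_gt0.
have sX : s `^ (3 / 2) = X.
  rewrite -powRrM (_ : 2 / 3 * (3 / 2) = 1); last by field.
  by rewrite powRr1// ltW.
have s3 : s ^+ 3 = X ^+ 2.
  rewrite -powR_mulrn ?powR_ge0// -powRrM.
  rewrite (_ : 2 / 3 * 3%:R = 2%:R); last by field.
  by rewrite powR_mulrn// ltW.
have M3 : M `^ (3 / 2) = m ^+ 3.
  rewrite -mE -powR_mulrn ?(ltW m0)// -powRrM.
  rewrite (_ : 2%:R * (3 / 2) = 3%:R); last by field.
  by rewrite powR_mulrn// ltW.
have fs : (mu3 [set x | (s < norm1 (f x))%R] <= (m ^+ 3 / X)%:E)%E.
  have := @le_weak_norm R (3 / 2) M s f _ (ltW M0) s0 fM.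
  rewrite sX M3 => H; rewrite mulrC EFinM lee_pdivlMl//; apply: H.
  by rewrite divr_gt0.
have bs := @mu3_ball_enorm R (s / t) (divr_gt0 s0 t0).
have sub : [set x | (t < norm1 (div_norm f x))%R] `<=`
    [set x | (s < norm1 (f x))%R] `|` [set x | (enorm x < s / t)%R].
  move=> x /=; rewrite norm1_div_norm => tx.
  have [?|fs'] := ltP s (norm1 (f x)); [by left|right].
  have x0 : 0 <= enorm x by exact: sqrtr_ge0.
  (* At the origin [0^-1 = 0] makes the quotient 0, which does not exceed [t > 0]. *)
  have {}x0 : 0 < enorm x.
    rewrite lt_neqAle x0 andbT; apply/eqP => e0.
    by rewrite -e0 invr0 mul0r in tx; lra.
  rewrite mulrC ltr_pdivlMr// in tx.
  by rewrite ltr_pdivlMr//; lra.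
have mf : measurable ([set x | (s < norm1 (f x))%R] : set (mR3 R)).
  by apply: measurable_superlevel; apply: measurable_norm1.
have mb := @measurable_ball_enorm R (s / t).
have md : measurable ([set x | (t < norm1 (div_norm f x))%R] : set (mR3 R)).
  (* Clearing the denominator away from the origin leaves superlevel sets of measurable
     functions. *)
  rewrite (_ : [set x | _] = [set x | 0 < norm1 (f x) - t * enorm x] `&`
      [set x | 0 < enorm x]).
    apply: measurableI; apply: measurable_superlevel.
    - apply: measurable_funB; first exact: measurable_norm1.
      by apply: measurable_funM => //; exact: measurable_enorm.
    - exact: measurable_enorm.
  apply/seteqP; split => x /=; rewrite norm1_div_norm.
    have := sqrtr_ge0 (x.1.1 ^+ 2 + x.1.2 ^+ 2 + x.2 ^+ 2).
    rewrite -/(enorm x) le_eqVlt => /predU1P[<-|x0].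
      by rewrite invr0 mul0r => ?; exfalso; lra.
    by rewrite mulrC ltr_pdivlMr// => ?; split => //; lra.
  by move=> [? x0]; rewrite mulrC ltr_pdivlMr//; lra.
have H : (mu3 [set x | (t < norm1 (div_norm f x))%R] <=
    (m ^+ 3 / X)%:E + (4 / 3 * pi * (s / t) ^+ 3)%:E)%E.
  apply: le_trans (leeD fs bs).
  apply: le_trans (measureU2 _ mf mb).
  by apply: le_measure => //; rewrite inE//; exact: measurableU.
apply: (@le_trans _ _
  (t%:E * ((m ^+ 3 / X)%:E + (4 / 3 * pi * (s / t) ^+ 3)%:E))%E).
  by apply: lee_wpmul2l => //; rewrite lee_fin ltW.
rewrite -EFinD -EFinM lee_fin exprMn exprVn s3.
(* Eliminating [pi] gives a rational identity in [m], [t], [k]: after multiplication by [t] the two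
   terms are [2 k m^2 / 3] and [k m^2 / 3], with sum [k * M]. *)
rewrite (_ : pi = k ^+ 3 / 9); last by rewrite k3; field.
rewrite -mE /X le_eqVlt; apply/orP; left; apply/eqP; field.
by rewrite !gt_eqF.
Qed.

(** If the right-hand quasi-norm is infinite, so is the right-hand side, as [k > 0]. If it is a real
    [w], the previous bound is applied with [M = w + e / k], which is positive even for [w = 0] and
    costs exactly [e]. *)
Lemma weak_norm_div_norm (R : realType) (f : R3 R -> spinor R) :
  Cc_infty f ->
  (weak_norm 1 (div_norm f) <=
     ((9 * pi) `^ (1 / 3))%:E * weak_norm (3 / 2) f)%E.
Proof.
move=> Cf; set k := _ `^ _.
have k0 : 0 < k by rewrite powR_gt0// mulr_gt0// pi_gt0.
have := @weak_norm_ge0 R (3 / 2) f.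
case E : weak_norm => [w| |] //; last first.
  by move=> _; rewrite gt0_muley ?lte_fin// leey.
rewrite lee_fin => w0; apply/lee_addgt0Pr => e e0.
have ke0 : 0 < w + e / k by rewrite ltr_wpDl// divr_gt0.
have -> : (k%:E * w%:E + e%:E = (k * (w + e / k))%:E)%E.
  by rewrite -EFinM -EFinD; congr EFin; field; rewrite gt_eqF.
(* Removing the exponent 1 requires a nonnegative supremum; the term at [t = 1] witnesses this. *)
rewrite /weak_norm invr1 poweRe1; last first.
  apply: le_trans (ereal_sup_ubound _); last by exists 1 => //=; exact: ltr01.
  by rewrite mule_ge0// lee_fin powR_ge0.
apply: ge_ereal_sup => _ [t /= t0 <-]; rewrite powRr1 ?(ltW t0)//.
apply: mu3_div_norm_le => //.
by rewrite E lee_fin lerDl ltW// divr_gt0.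
Qed.

Theorem theorem2p2 (R : realType) (C1 : R)
    (hC1 : is_smallest
             [set C : R | forall f : R3 R -> spinor R, Cc_infty f ->
                (weak_norm (3 / 2) f <=
                   C%:E * \int[mu3]_x (norm1 (sigma_p f x))%:E)%E] C1) :
  exists C2 : R, C2 <= (9 * pi) `^ (1 / 3) * C1 /\
    forall f : R3 R -> spinor R, Cc_infty f ->
      (weak_norm 1 (div_norm f) <=
         C2%:E * \int[mu3]_x (norm1 (sigma_p f x))%:E)%E.
Proof.
exists ((9 * pi) `^ (1 / 3) * C1); split => // f Cf.
apply: (le_trans (weak_norm_div_norm _ _ Cf)).
rewrite EFinM -muleA; apply: lee_wpmul2l; first by rewrite lee_fin powR_ge0.
exact: hC1.1.
Qed.
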